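(* For any integer $k\ge 3$ and any graph $G$ with $P(G,k)=P_{\ell}(G,k)>0$, there exists an infinite set $\mathcal{G}^{np}(G)$ of (pairwise non-isomorphic) graphs such that for each graph $G'\in\mathcal{G}^{np}(G)$, $P(G',k)=P_{\ell}(G',k)>0$ but $P(G',k+1)>P_{\ell}(G',k+1)$.
   Context: All graphs are finite and simple. $\mathbb{N}$ denotes the set of positive integers and $[k]=\{1,\dots,k\}$. A proper coloring of a graph $G$ is a map $\theta:V(G)\to\mathbb{N}$ with $\theta(u)\ne\theta(v)$ for all $uv\in E(G)$. For $k\in\mathbb{N}$, $P(G,k)$ (the chromatic polynomial) is the number of proper colorings $\theta$ of $G$ with $\theta(v)\in[k]$ for all $v\in V(G)$. A list assignment $L$ of $G$ assigns to each vertex $v$ a subset $L(v)\subseteq\mathbb{N}$; it is a $k$-list assignment if $|L(v)|=k$ for all $v\in V(G)$. An $L$-coloring is a proper coloring $\theta$ with $\theta(v)\in L(v)$ for all $v$, and $P(G,L)$ is the number of $L$-colorings of $G$. The list-color function $P_{\ell}(G,k)$ is the minimum of $P(G,L)$ over all $k$-list assignments $L$ of $G$. *)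

(* Defs.v *)
From HB Require Import structures.
From mathcomp Require Import all_boot finmap.
From mathcomp Require Import boolp.

Set Implicit Arguments.
Unset Strict Implicit.
Unset Printing Implicit Defensive.

Local Open Scope fset_scope.

Record sgraph := SGraph {
  vert :> finType;
  adj : rel vert;
  adj_sym : symmetric adj;
  adj_irr : irreflexive adj }.

Definition isomorphic (G H : sgraph) : Prop :=
  exists2 f : G -> H, bijective f & forall u v, adj (f u) (f v) = adj u v.

(* The [infinite_set] of mathcomp-classical cannot be used: the universe of
   [set] is below that of [finType], hence too small for [sgraph]. *)
Definition finite_class (A : sgraph -> Prop) : Prop :=
  exists (n : nat) (f : 'I_n -> sgraph), forall G, A G -> exists i, f i = G.

Definition infinite_class (A : sgraph -> Prop) : Prop := ~ finite_class A.

Definition proper_coloring (G : sgraph) (t : G -> nat) : bool :=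
  [forall u, forall v, adj u v ==> (t u != t v)].

(* [k] = {1, ..., k} *)
Definition colors (k : nat) : {fset nat} := [fset i in iota 1 k].

Definition chrom_poly (G : sgraph) (k : nat) : nat :=
  #|[set t : {ffun G -> colors k} | proper_coloring (fun v => val (t v))]|.

(* The positivity condition on colours belongs to [klist_assignment], as does
   the size of the lists; finite lists suffice since only k-list assignments
   are ever considered. *)
Definition list_assignment (G : sgraph) : Type := G -> {fset nat}.

Definition klist_assignment (G : sgraph) (k : nat) (L : list_assignment G) :
    Prop :=
  forall v, #|` L v| = k /\ (forall c, c \in L v -> 0 < c).

Definition all_colors (G : sgraph) (L : list_assignment G) : {fset nat} :=
  \big[fsetU/fset0]_(v : G) L v.

(* An L-coloring takes its values in the union of the lists, so counting inside
   the finite type of functions into that union loses nothing. *)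
Definition num_list_colorings (G : sgraph) (L : list_assignment G) : nat :=
  #|[set t : {ffun G -> all_colors L} |
      proper_coloring (fun v => val (t v)) && [forall v, val (t v) \in L v]]|.

Definition num_list_colorings_attained (G : sgraph) (k m : nat) : Prop :=
  exists2 L : list_assignment G,
    klist_assignment k L & num_list_colorings L = m.

Lemma klist_assignment_colors (G : sgraph) (k : nat) :
  klist_assignment k (fun _ : G => colors k).
Proof.
move=> v; split.
  by rewrite card_fseq undup_id ?iota_uniq // size_iota.
by move=> c; rewrite !inE /= mem_iota => /andP[].
Qed.

Lemma ex_num_list_colorings (G : sgraph) (k : nat) :
  exists m, `[< num_list_colorings_attained G k m >].
Proof.
exists (num_list_colorings (fun _ : G => colors k)); apply/asboolP.
by exists (fun _ => colors k) => //; exact: klist_assignment_colors.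
Qed.

Definition list_color_fun (G : sgraph) (k : nat) : nat :=
  ex_minn (ex_num_list_colorings G k).

(* Main.v *)
(* Extending a graph by an independent set [W], each [w] being joined to a set
   [N w] on which every proper [k]-colouring is injective, preserves
   [P(_, k) = P_l(_, k)]: both sides get multiplied by the [k - #|N w|].
   Starting from [G], such extensions add a [k]-clique [K], then [u] joined to a
   single [x] in [K] and [v] joined to the rest of [K].  With [k] colours, [v] is
   forced to repeat the colour of [x], so [u] and [v] always differ, and a large
   [W] joined to [u] and [v] is again such an extension.  With [k+1] colours [u]
   and [v] may agree, which alone gives [k ^ #|W|] colourings, whereas disjoint
   lists on [u] and [v] force them apart; the lists on [W] can be spread so that
   each choice of colours for [u] and [v] leaves exponentially fewer. *)
Require Import Defs.
From mathcomp Require Import all_boot finmap.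
From mathcomp Require Import boolp.
From mathcomp Require Import zify.

Set Implicit Arguments.
Unset Strict Implicit.
Unset Printing Implicit Defensive.

(** * Colorings with colours in an arbitrary finite type *)

Definition proper (G : sgraph) (C : eqType) (t : G -> C) : bool :=
  [forall u, forall v, adj u v ==> (t u != t v)].

Lemma properP (G : sgraph) (C : eqType) (t : G -> C) :
  reflect (forall u v, adj u v -> t u != t v) (proper t).
Proof.
apply: (iffP forallP) => h u; first by move=> v; exact/implyP/(forallP (h u)).
by apply/forallP => v; apply/implyP/h.
Qed.

Lemma proper_comp (G : sgraph) (C C' : eqType) (f : C -> C') (t : G -> C) :
  injective f -> proper (fun v => f (t v)) = proper t.
Proof.
move=> fI; apply/properP/properP => tP u v /tP; first by rewrite (inj_eq fI).
by rewrite (inj_eq fI).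
Qed.

Definition lcolorings (C : finType) (G : sgraph) (M : G -> {set C}) :
    {set {ffun G -> C}} :=
  [set t : {ffun G -> C} | proper t && [forall v, t v \in M v]].

Lemma lcoloringsP (C : finType) (G : sgraph) (M : G -> {set C})
    (t : {ffun G -> C}) :
  reflect ((forall u v, adj u v -> t u != t v) /\ (forall v, t v \in M v))
          (t \in lcolorings M).
Proof.
rewrite inE; apply: (iffP andP) => -[h1 h2].
  by split; [apply/properP | apply/forallP].
by split; [apply/properP | apply/forallP].
Qed.

(** Composing with [f] or [f'] embeds both sets of colorings among the functions to [nat].
    Membership there depends only on the numeric images of the lists, so the two images coincide. *)
Lemma card_lcolorings_transfer (C C' : finType) (G : sgraph)
    (f : C -> nat) (f' : C' -> nat) (M : G -> {set C}) (M' : G -> {set C'}) :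
  injective f -> injective f' ->
  (forall v, [seq f c | c in M v] =i [seq f' c | c in M' v]) ->
  #|lcolorings M| = #|lcolorings M'|.
Proof.
pose pushed (D : finType) (g : D -> nat) (L : G -> {set D}) :=
  [seq ([ffun v => g (t v)] : {ffun G -> nat}) | t : {ffun G -> D} in lcolorings L].
have pushed_uniq (D : finType) (g : D -> nat) L :
    injective g -> uniq (pushed D g L).
  move=> gI; rewrite map_inj_uniq ?enum_uniq // => s t /ffunP st.
  by apply/ffunP => v; apply: gI; move: (st v); rewrite !ffunE.
have mem_pushed (D : finType) (g : D -> nat) L s : injective g ->
    (s \in pushed D g L) = proper s &&
      [forall v, s v \in [seq g c | c in L v]].
  move=> gI; apply/imageP/andP => [[t /lcoloringsP[tP tL] ->]|[/properP sP /forallP sL]].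
    split; last first.
      by apply/forallP => v; rewrite ffunE; apply: image_f.
    by apply/properP => u v /tP; rewrite !ffunE (inj_eq gI).
  have gE v : g (iinv (sL v)) = s v by exact: f_iinv.
  exists [ffun v => iinv (sL v)].
    apply/lcoloringsP; split => [u v uv|v]; rewrite !ffunE; last exact: mem_iinv.
    by move: (sP u v uv); apply: contraNneq => e; rewrite -(gE u) -(gE v) e.
  by apply/ffunP => v; rewrite !ffunE gE.
move=> fI f'I MM'.
have /perm_size : perm_eq (pushed C f M) (pushed C' f' M').
  apply: uniq_perm; rewrite ?pushed_uniq // => s.
  by rewrite !mem_pushed //; congr (_ && _); apply: eq_forallb => v; rewrite MM'.
by rewrite !size_map -!cardE.
Qed.

Lemma chrom_polyE (G : sgraph) (k : nat) :
  chrom_poly G k = #|lcolorings (fun _ : G => [set: 'I_k])|.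
Proof.
(* ['I_k] starts at 0 but the colours start at 1. *)
pose f (i : 'I_k) := (val i).+1.
transitivity #|lcolorings (fun _ : G => [set: colors k])|.
  apply: eq_card => t; rewrite !inE.
  rewrite [X in _ = _ && X](_ : _ = true) ?andbT; last first.
    by apply/forallP => v; rewrite inE.
  exact: (proper_comp _ val_inj).
apply: (@card_lcolorings_transfer _ _ _ val f) => [||v c].
- exact: val_inj.
- by move=> i j [] /val_inj.
apply/imageP/imageP => -[x _ ->].
  have := valP x; rewrite /colors !inE /= mem_iota add1n => /andP[x0 xk].
  have xk' : (val x).-1 < k by rewrite -ltnS prednK.
  by exists (Ordinal xk'); rewrite ?inE // /f /= prednK.
have xk : f x \in colors k by rewrite !inE /= mem_iota /f /= add1n ltnS ltn_ord.
by exists [` xk]%fset; rewrite ?inE.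
Qed.

Lemma num_list_coloringsE (G : sgraph) (L : list_assignment G) :
  num_list_colorings L =
  #|lcolorings (fun v => [set c : all_colors L | val c \in L v])|.
Proof.
apply: eq_card => t; rewrite !inE; congr (_ && _).
by apply: eq_forallb => v; rewrite inE.
Qed.

Lemma mem_all_colors (G : sgraph) (L : list_assignment G) v c :
  c \in L v -> c \in all_colors L.
Proof. by move=> cL; apply/bigfcupP; exists v; rewrite // mem_index_enum. Qed.

(** With [list_color_fun_le], this characterises the list-color function as a minimum over lists in
    arbitrary finite types, so natural-number lists are not handled again. *)
Lemma list_color_fun_attained (G : sgraph) (k : nat) :
  exists (C : finType) (M : G -> {set C}),
    (forall v, #|M v| = k) /\ list_color_fun G k = #|lcolorings M|.
Proof.
rewrite /list_color_fun; case: ex_minnP => m /asboolP[L Lk <-] _.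
exists (all_colors L : finType), (fun v => [set c : all_colors L | val c \in L v]).
split=> [v|]; last exact: num_list_coloringsE.
rewrite -(Lk v).1.
have /perm_size : perm_eq [seq val c | c : all_colors L in
    [set c : all_colors L | val c \in L v]] (L v).
  apply: uniq_perm; rewrite ?fset_uniq ?(map_inj_uniq val_inj) ?enum_uniq // => c.
  apply/imageP/idP => [[x] | cL]; first by rewrite inE => xL ->.
  by exists [` mem_all_colors cL]%fset; rewrite // inE.
by rewrite size_map -cardE.
Qed.

Lemma list_color_fun_le (G : sgraph) (k : nat) (C : finType)
    (M : G -> {set C}) :
  (forall v, #|M v| = k) -> list_color_fun G k <= #|lcolorings M|.
Proof.
(* The successor makes every colour positive, as [klist_assignment] demands. *)
move=> Mk; pose f (c : C) := (val (enum_rank c)).+1.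
have fI : injective f by move=> c d [] /val_inj /enum_rank_inj.
pose L : list_assignment G := fun v => [fset c in [seq f c | c in M v]]%fset.
have -> : #|lcolorings M| = num_list_colorings L.
  rewrite num_list_coloringsE.
  apply: (card_lcolorings_transfer fI val_inj) => v c.
  apply/idP/imageP => [cM|[x]].
    have cL : c \in L v by rewrite !inE.
    by exists [` mem_all_colors cL]%fset; rewrite // inE.
  by rewrite !inE => xM ->.
rewrite /list_color_fun; case: ex_minnP => m _; apply; apply/asboolP.
exists L => // v; split.
  rewrite card_fseq undup_id ?size_map -?cardE //.
  by rewrite map_inj_uniq ?enum_uniq.
by move=> c; rewrite !inE /= => /imageP[x _ ->].
Qed.

Lemma list_color_fun_le_chrom (G : sgraph) (k : nat) :
  list_color_fun G k <= chrom_poly G k.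
Proof.
by rewrite chrom_polyE list_color_fun_le // => v; rewrite cardsT card_ord.
Qed.

(** * Extension of a graph by an independent set *)

Section Extension.
Variables (H : sgraph) (W : finType) (N : W -> {set H}).

Definition ext_adj (x y : H + W) : bool :=
  match x, y with
  | inl a, inl b => adj a b
  | inl a, inr w => a \in N w
  | inr w, inl a => a \in N w
  | inr _, inr _ => false
  end.

Lemma ext_adj_sym : symmetric ext_adj.
Proof. by move=> [a|w] [b|z] //=; exact: adj_sym. Qed.

Lemma ext_adj_irr : irreflexive ext_adj.
Proof. by move=> [a|w] //=; exact: adj_irr. Qed.

Definition ext : sgraph := SGraph ext_adj_sym ext_adj_irr.

Lemma card_ext : #|ext| = #|H| + #|W|.
Proof. exact: card_sum. Qed.

(** Since [W] is independent, once [h] is fixed on [H] each [w] chooses separately among the colours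
    of its list that [h] does not use on [N w]. *)
Lemma card_lcolorings_ext (C : finType) (M : ext -> {set C}) :
  #|lcolorings M| = \sum_(h in lcolorings (fun v : H => M (inl v)))
                      \prod_(w : W) #|M (inr w) :\: h @: N w|.
Proof.
pose rH (t : {ffun ext -> C}) : {ffun H -> C} := [ffun v => t (inl v)].
pose rW (t : {ffun ext -> C}) : {ffun W -> C} := [ffun w => t (inr w)].
pose join (h : {ffun H -> C}) (g : {ffun W -> C}) : {ffun ext -> C} :=
  [ffun x : H + W => match x with inl v => h v | inr w => g w end].
have joinK t : join (rH t) (rW t) = t.
  by apply/ffunP => -[v|w]; rewrite !ffunE.
rewrite -sum1_card (partition_big rH (mem (lcolorings (fun v => M (inl v))))).
  apply: eq_bigr => h /lcoloringsP[hP hM].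
  rewrite (reindex_onto (join h) rW) => [|t /andP[_ /eqP <-]]; last exact: joinK.
  have := card_family (fun w : W => mem (M (inr w) :\: h @: N w)).
  rewrite foldrE big_map big_enum /= => <-.
  rewrite -sum1_card; apply: eq_bigl => g.
  have -> : rW (join h g) == g by apply/eqP/ffunP => w; rewrite !ffunE.
  have -> : rH (join h g) == h by apply/eqP/ffunP => v; rewrite !ffunE.
  rewrite !andbT; apply/(@lcoloringsP C ext M (join h g))/familyP => [[gP gM] w | gN].
    rewrite inE; have := gM (inr w); rewrite ffunE => -> /[!andbT].
    apply/imsetP => -[v vN e].
    by have /(_ vN) := gP (inl v) (inr w); rewrite !ffunE e eqxx.
  split=> [[v|w] [v'|w'] //=|[v|w]]; rewrite !ffunE //.
  - exact: hP.
  - move=> vN; have := gN w'; rewrite inE => /andP[+ _].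
    by apply: contraNneq => <-; exact: imset_f.
  - move=> vN; have := gN w; rewrite inE => /andP[+ _].
    by apply: contraNneq => ->; exact: imset_f.
  - by have := gN w; rewrite inE => /andP[].
move=> t /lcoloringsP[tP tM]; apply/lcoloringsP; split=> [u v uv|v].
  by rewrite !ffunE; apply: tP.
by rewrite !ffunE.
Qed.

Lemma chrom_poly_ext (k : nat) :
  (forall h : {ffun H -> 'I_k}, proper h -> forall w, {in N w &, injective h}) ->
  chrom_poly ext k = chrom_poly H k * \prod_(w : W) (k - #|N w|).
Proof.
move=> inj; rewrite !chrom_polyE card_lcolorings_ext.
rewrite (eq_bigr (fun _ => \prod_(w : W) (k - #|N w|))) => [|h].
  by rewrite sum_nat_const.
move=> /lcoloringsP[/properP hP _]; apply: eq_bigr => w _.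
by rewrite setTD cardsCs setCK card_ord card_in_imset //; exact: inj.
Qed.

(** The neighbours of [w] exclude at most [#|N w|] of the [k] colours in its list, whatever the
    coloring of [H]. *)
Lemma list_color_fun_ext (k : nat) :
  list_color_fun H k * \prod_(w : W) (k - #|N w|) <= list_color_fun ext k.
Proof.
have [C [M [Mk ->]]] := list_color_fun_attained ext k.
rewrite card_lcolorings_ext.
apply: leq_trans (leq_mul (list_color_fun_le (fun v => Mk (inl v))) (leqnn _)) _.
rewrite -sum_nat_const; apply: leq_sum => h _; apply: leq_prod => w _.
rewrite leq_subLR -(Mk (inr w)) -(cardsID (h @: N w)) leq_add2r.
by rewrite (leq_trans (subset_leq_card (subsetIr _ _))) ?leq_imset_card.
Qed.

Lemma chrom_list_color_ext (k : nat) :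
  chrom_poly H k = list_color_fun H k ->
  (forall h : {ffun H -> 'I_k}, proper h -> forall w, {in N w &, injective h}) ->
  chrom_poly ext k = list_color_fun ext k.
Proof.
move=> HE inj; apply/eqP; rewrite eqn_leq list_color_fun_le_chrom andbT.
by rewrite chrom_poly_ext // HE list_color_fun_ext.
Qed.

End Extension.

(** * Two vertices that [k] colours always separate and [k.+1] colours may not *)

Definition clique (G : sgraph) (K : {set G}) : Prop :=
  {in K &, forall u v, u != v -> adj u v}.

Lemma clique_inj (G : sgraph) (C : eqType) (K : {set G}) (t : G -> C) :
  clique K -> proper t -> {in K &, injective t}.
Proof.
move=> cK /properP tP u v uK vK tuv; apply/eqP; apply: contraT => uv.
by have := tP u v (cK u v uK vK uv); rewrite tuv eqxx.
Qed.

Lemma chrom_poly_gt0P (G : sgraph) (k : nat) :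
  reflect (exists h : {ffun G -> 'I_k}, proper h) (0 < chrom_poly G k).
Proof.
rewrite chrom_polyE; apply: (iffP card_gt0P) => -[h hP]; exists h.
  by case/lcoloringsP: hP => hP _; apply/properP.
by apply/lcoloringsP; split=> [|v]; [apply/properP | rewrite inE].
Qed.

(** Each step joins one new vertex to the whole current clique, of size [j < k], so the factor
    [k - j] stays positive. *)
Lemma exists_ext_clique (G : sgraph) (k j : nat) :
  chrom_poly G k = list_color_fun G k -> 0 < list_color_fun G k -> j <= k ->
  exists (H : sgraph) (K : {set H}),
    [/\ chrom_poly H k = list_color_fun H k, 0 < list_color_fun H k,
        clique K & #|K| = j].
Proof.
move=> GE G0; elim: j => [_|j IH jk].
  by exists G, set0; split; rewrite ?cards0 // => u v; rewrite inE.
have [H [K [HE H0 cK Kj]]] := IH (ltnW jk).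
pose N (_ : unit) := K.
exists (ext N), (inr tt |: inl @: K); split.
- by apply: chrom_list_color_ext => // h hP w; exact: (clique_inj cK hP).
- apply: leq_trans (list_color_fun_ext N k).
  by rewrite muln_gt0 H0 prodn_gt0 // => b; rewrite /N Kj subn_gt0.
- move=> x y /setU1P[->|/imsetP[a aK ->]] /setU1P[->|/imsetP[b bK ->]] //.
  by move=> ab; apply: cK.
- rewrite cardsU1 card_imset ?Kj; last by move=> a b [].
  by rewrite (_ : inr tt \notin _) //; apply/imsetP => -[].
Qed.

Lemma exists_ext_separated (G : sgraph) (k : nat) :
  2 <= k -> chrom_poly G k = list_color_fun G k -> 0 < list_color_fun G k ->
  exists (H : sgraph) (u v : H),
    [/\ chrom_poly H k = list_color_fun H k, 0 < list_color_fun H k,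
        forall h : {ffun H -> 'I_k}, proper h -> h u != h v
      & exists2 h : {ffun H -> 'I_k.+1}, proper h & h u = h v].
Proof.
move=> k2 GE G0.
have [H [K [HE H0 cK Kk]]] := exists_ext_clique GE G0 (leqnn k).
have /card_gt0P[x xK] : 0 < #|K| by rewrite Kk ltnW.
pose N (b : bool) := if b then [set x] else K :\ x.
have Nk b : #|N b| < k.
  case: b; rewrite /N ?cards1 //.
  by move: (cardsD1 x K); rewrite xK Kk => ->.
have Ninj (C : eqType) (h : {ffun H -> C}) :
    proper h -> forall b, {in N b &, injective h}.
  move=> hP b; apply: sub_in2 (clique_inj cK hP).
  by case: b => y; rewrite !inE; [move/eqP-> | case/andP].
exists (ext N), (inr true), (inr false); split.
- by apply: chrom_list_color_ext => // h hP b; exact: Ninj.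
- apply: leq_trans (list_color_fun_ext N k).
  by rewrite muln_gt0 H0 prodn_gt0 // => b; rewrite subn_gt0.
- move=> t /properP tP.
  have sP : proper (fun a => t (inl a)) by apply/properP => a b ab; apply: tP.
  (* The [k]-clique uses all [k] colours, so [inr false] repeats the colour of some [y] in [K]; its
     neighbours being [K :\ x], that [y] is [x]. *)
  have : t (inr false) \in [set t (inl a) | a in K].
    suff -> : [set t (inl a) | a in K] = setT by rewrite inE.
    apply/eqP; rewrite eqEcard subsetT cardsT card_ord /=.
    by rewrite card_in_imset ?Kk //; exact: clique_inj.
  case/imsetP => y yK ty.
  have [yx|yx] := eqVneq y x; last first.
    by have := tP (inl y) (inr false); rewrite /= !inE yx yK ty eqxx => /(_ isT).
  by rewrite ty yx; apply: tP; rewrite /= inE.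
have /chrom_poly_gt0P[h /properP hP] : 0 < chrom_poly H k by rewrite HE.
(* A proper [k]-coloring of [H] is lifted to avoid [ord_max], which both new vertices then share. *)
exists [ffun a : H + bool => if a is inl b then lift ord_max (h b) else ord_max].
  apply/properP => -[a|a] [b|b] //=; rewrite !ffunE //.
  - by rewrite (inj_eq lift_inj); exact: hP.
  - by rewrite eq_sym neq_lift.
  - by rewrite neq_lift.
by rewrite !ffunE.
Qed.

(** * Auxiliary estimates and cardinalities *)

Lemma exp_eventually_gt (c q m r : nat) :
  0 < q -> q < m -> c * q <= r -> c * q ^ r < m ^ r.
Proof.
move=> q0 qm cr.
(* Bernoulli's inequality for [(1 + 1/q) ^ s], cleared of denominators. *)
have bern s : (q + s) * q ^ s <= q * q.+1 ^ s.
  elim: s => [|s IH]; first by rewrite addn0 !expn0.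
  rewrite !expnS [leqRHS]mulnCA.
  apply: leq_trans (leq_mul (leqnn q.+1) IH).
  by rewrite mulnA mulnA leq_mul2r; apply/orP; right; nia.
apply: leq_trans (_ : q.+1 ^ r <= _); last by case: (r) => // s; rewrite leq_exp2r.
rewrite -(ltn_pmul2l q0); apply: leq_trans (bern r).
rewrite mulnA ltn_pmul2r ?expn_gt0 ?q0 //; nia.
Qed.

Lemma cardsD2 (T : finType) (A : {set T}) (x y : T) :
  x != y -> #|A :\: [set x; y]| = #|A| - (x \in A) - (y \in A).
Proof.
move=> xy; rewrite -setDDl [#|A|](cardsD1 x) addKn.
by rewrite [#|A :\ x|](cardsD1 y) !inE eq_sym xy addKn.
Qed.

Lemma inr_notin_inl (T U : finType) (A : {set T}) (b : U) :
  (inr b \in [set (inl a : T + U) | a in A]) = false.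
Proof. by apply/negP => /imsetP[]. Qed.

(** * The gadget: many common neighbours of [u] and [v] *)

Section Gadget.
Variables (H : sgraph) (u v : H) (k r : nat).

(** The two ['I_k.+1] coordinates will index the lists on the new vertices; ['I_r] provides [r]
    copies of each, raising a fixed ratio to the power [r]. *)
Definition gadget : sgraph :=
  ext (fun _ : 'I_k.+1 * 'I_k.+1 * 'I_r => [set u; v]).

Lemma card_gadget : #|gadget| = #|H| + k.+1 * k.+1 * r.
Proof. by rewrite card_ext !card_prod !card_ord. Qed.

(* Over all pairs [(i, j)], a given colour of [u] is in a proportion
   [k / (k+1)] of the lists and a given colour of [v] in [1 / (k+1)]: exactly
   one colour is lost on average, but unevenly, so that by concavity the product
   of the numbers of remaining colours is below [k ^ (k.+1 * k.+1)]. *)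
Definition gadget_list (x : gadget) : {set 'I_k.+1 + 'I_k.+1} :=
  match x with
  | inl z => if z == v then inr @: setT else inl @: setT
  | inr (i, j, _) => (inr j) |: (inl @: [set~ i])
  end.

Lemma card_gadget_list x : #|gadget_list x| = k.+1.
Proof.
have inlI : injective (@inl 'I_k.+1 'I_k.+1) by move=> a b [].
have inrI : injective (@inr 'I_k.+1 'I_k.+1) by move=> a b [].
case: x => [z|[[i j] s]] /=.
  by case: ifP => _; rewrite card_imset // cardsT card_ord.
by rewrite cardsU1 inr_notin_inl card_imset // cardsC1 card_ord.
Qed.

(** Only the term of a coloring with [h u = h v] is kept: there each new vertex has [k] colours
    left. *)
Lemma chrom_gadget :
  (exists2 h : {ffun H -> 'I_k.+1}, proper h & h u = h v) ->
  (k ^ (k.+1 * k.+1)) ^ r <= chrom_poly gadget k.+1.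
Proof.
case=> h hP huv; rewrite chrom_polyE card_lcolorings_ext.
have hin : h \in lcolorings (fun _ : H => [set: 'I_k.+1]).
  by apply/lcoloringsP; split=> [|z]; [apply/properP | rewrite inE].
rewrite (bigD1 h) //= imsetU1 imset_set1 huv setUid.
rewrite (eq_bigr (fun _ => k)) => [|w _]; last by rewrite setTD cardsC1 card_ord.
by rewrite prod_nat_const !card_prod !card_ord -expnM leq_addr.
Qed.

(** The product of the numbers of remaining colours over all pairs [(i, j)], for colours [inl a] on
    [u] and [inr b] on [v]: the row [i = a] gives [k * k.+1 ^ k], each of the [k] other rows
    [k.-1 * k ^ k]. *)
Definition gadget_base := k * k.+1 ^ k * ((k.-1 * k ^ k) ^ k).

Lemma gadget_base_gt0 : 2 <= k -> 0 < gadget_base.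
Proof.
move=> k2; rewrite /gadget_base !muln_gt0 (ltnW k2) expn_gt0 /= expn_gt0 muln_gt0.
by rewrite expn_gt0 (ltnW k2) -subn1 subn_gt0 k2.
Qed.

(** After cancelling common powers of [k], this is [(k.+1 * k.-1) ^ k < (k ^ 2) ^ k]. *)
Lemma gadget_base_lt : 2 <= k -> gadget_base < k ^ (k.+1 * k.+1).
Proof.
move=> k2; have k0 : 0 < k by lia.
have -> : k.+1 * k.+1 = 1 + 2 * k + k * k by lia.
rewrite (expnD k (1 + 2 * k)) (expnD k 1) expn1 (expnM k 2 k) (expnM k k k).
rewrite /gadget_base expnMn.
rewrite mulnA ltn_pmul2r ?expn_gt0 ?k0 // -!mulnA ltn_pmul2l //.
by rewrite -expnMn ltn_exp2r //; nia.
Qed.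

Lemma prod_gadget_list (a b : 'I_k.+1) :
  \prod_(w : 'I_k.+1 * 'I_k.+1 * 'I_r)
     #|gadget_list (inr w) :\: [set inl a; inr b]| = gadget_base ^ r.
Proof.
have F i j s : #|gadget_list (inr (i, j, s)) :\: [set inl a; inr b]| =
    k.+1 - (i != a) - (j == b).
  have inlI : injective (@inl 'I_k.+1 'I_k.+1) by move=> x y [].
  rewrite cardsD2 // card_gadget_list /= !inE inr_notin_inl (mem_imset _ _ inlI).
  by rewrite !inE orbF /= eq_sym; congr (_ - _); rewrite eq_sym.
rewrite (eq_bigr (fun w => k.+1 - (w.1.1 != a) - (w.1.2 == b)));
  last by case=> [[i j] s].
rewrite -(pair_bigA _ (fun p _ => k.+1 - (p.1 != a) - (p.2 == b))) /=.
under eq_bigr do rewrite prod_nat_const card_ord.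
rewrite -(big_morph (expn^~ r) (fun x y => expnMn x y r) (exp1n r)).
rewrite -(pair_bigA _ (fun i j => k.+1 - (i != a) - (j == b))) /=.
congr (_ ^ _).
(* In each row, the column [j = b] loses one colour more than the [k] other columns. *)
have P i : \prod_j (k.+1 - (i != a) - (j == b)) =
  (k - (i != a)) * (k.+1 - (i != a)) ^ k.
  rewrite (bigD1 b) //= eqxx (eq_bigr (fun _ => k.+1 - (i != a))).
    by rewrite prod_nat_const cardC1 card_ord subnAC subn1.
  by move=> j /negPf ->; rewrite subn0.
under eq_bigr do rewrite P.
rewrite (bigD1 a) //= eqxx !subn0 (eq_bigr (fun _ => k.-1 * k ^ k)).
  by rewrite prod_nat_const cardC1 card_ord.
by move=> i ->; rewrite subn1 subn1.
Qed.

(** The palettes of [u] and [v] are disjoint, so every coloring of [H] from these lists contributes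
    the same [gadget_base ^ r]; dropping properness bounds their number by [k.+1 ^ #|H|]. *)
Lemma list_color_gadget :
  u != v -> list_color_fun gadget k.+1 <= k.+1 ^ #|H| * gadget_base ^ r.
Proof.
move=> uv; apply: leq_trans (list_color_fun_le card_gadget_list) _.
rewrite card_lcolorings_ext.
set A := lcolorings _.
have -> : \sum_(h in A) \prod_w #|gadget_list (inr w) :\: h @: [set u; v]| =
    \sum_(h in A) gadget_base ^ r.
  apply: eq_bigr => h /lcoloringsP[_ hL].
  have := hL u; rewrite /= (negPf uv) => /imsetP[a _ hu].
  have := hL v; rewrite /= eqxx => /imsetP[b _ hv].
  by rewrite -(prod_gadget_list a b) imsetU1 imset_set1 hu hv.
rewrite sum_nat_const leq_mul2r; apply/orP; right.
apply: leq_trans (_ : #|family (fun z : H => mem (gadget_list (inl z)))| <= _).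
  by apply: subset_leq_card; apply/subsetP => h /lcoloringsP[_ hL]; apply/familyP.
rewrite card_family foldrE big_map big_enum /=.
rewrite (eq_bigr (fun _ => k.+1)) ?prod_nat_const // => z _.
by rewrite -[RHS](card_gadget_list (inl z)); apply: eq_card.
Qed.

End Gadget.

(** * The infinite family *)

Theorem theorem7 (k : nat) (G : sgraph) (hk : 3 <= k)
    (hG : chrom_poly G k = list_color_fun G k) (hpos : 0 < list_color_fun G k) :
  exists Gnp : sgraph -> Prop,
    [/\ infinite_class Gnp,
        (forall G1 G2 : sgraph, Gnp G1 -> Gnp G2 -> G1 <> G2 ->
           ~ isomorphic G1 G2)
      & (forall G' : sgraph, Gnp G' ->
           [/\ chrom_poly G' k = list_color_fun G' k,
               0 < list_color_fun G' k
             & list_color_fun G' k.+1 < chrom_poly G' k.+1])].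
Proof.
have [H [u [v [HE H0 sep glue]]]] := exists_ext_separated (ltnW hk) hG hpos.
have /chrom_poly_gt0P[h0 /sep h0uv] : 0 < chrom_poly H k by rewrite HE.
have uv : u != v by apply: contraNneq h0uv => ->.
(* The threshold of [exp_eventually_gt] for [c = k.+1 ^ #|H|] and [q = gadget_base k]. *)
pose r0 := k.+1 ^ #|H| * gadget_base k.
pose F r := gadget u v k (r0 + r).
have cardF r : #|F r| = #|H| + k.+1 * k.+1 * (r0 + r) by exact: card_gadget.
exists (fun G' => exists r, G' = F r); split.
- move=> [n [f fP]].
  (* With the sum of all enumerated orders as parameter, the graph has more vertices than any
     enumerated one. *)
  have [i fi] := fP (F (\sum_i #|f i|)) (ex_intro _ _ erefl).
  have := cardF (\sum_i #|f i|); rewrite -fi => fiE.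
  have : #|f i| <= \sum_i #|f i| by rewrite (bigD1 i) //= leq_addr.
  have : 0 < r0 by rewrite muln_gt0 expn_gt0 gadget_base_gt0 // ltnW.
  by nia.
(* The number of vertices determines the parameter. *)
- move=> _ _ [r ->] [s ->] ne [f /bij_eq_card fE _]; apply: ne; congr F.
  by move: fE; rewrite !cardF => /addnI/eqP; rewrite eqn_mul2l eqn_add2l => /eqP.
move=> _ [r ->]; split.
(* Separation by [sep] is injectivity on [[set u; v]]. *)
- apply: chrom_list_color_ext => // h /sep huv _ x y.
  rewrite !inE => /orP[]/eqP-> /orP[]/eqP-> // e; move: huv; rewrite e eqxx //.
- apply: leq_trans (list_color_fun_ext _ k).
  by rewrite muln_gt0 H0 prodn_gt0 // => w; rewrite cards2 uv subn_gt0.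
apply: leq_ltn_trans (list_color_gadget _ _ uv) _.
apply: leq_trans (chrom_gadget _ glue).
by apply: exp_eventually_gt; rewrite ?gadget_base_gt0 ?gadget_base_lt ?leq_addr // ltnW.
Qed.
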